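(* Let $w\ge3$ and $N\ge1$ be integers. For $f\in\mathrm{Fil}^W_w(\mathcal{MD}_N)$ put $Z_w(f)=\lim_{q\to1^-}(1-q)^w f(q\eta^{-1})$. Then $\mathrm{Fil}^W_{w-1}(\mathcal{MD}_N)\subseteq\ker(Z_w)$ and $\mathfrak D\,\mathrm{Fil}^W_{w-2}(\mathcal{MD}_N)\subseteq\ker(Z_w)$, where $\mathfrak D=q\frac{d}{dq}$; that is, for every $f\in\mathrm{Fil}^W_{w-1}(\mathcal{MD}_N)$ one has $\lim_{q\to1^-}(1-q)^wf(q\eta^{-1})=0$, and for every $f\in\mathrm{Fil}^W_{w-2}(\mathcal{MD}_N)$ one has $\lim_{q\to1^-}(1-q)^w(\mathfrak Df)(q\eta^{-1})=0$.
   Context: $\eta=e^{2\pi i/N}$, $\mathbb Q_N=\mathbb Q(\eta)$, $\mathbb N=\{1,2,\dots\}$. For $d\ge 0$, $\mathbf s\in\mathbb N^d$, $\boldsymbol\alpha\in(\mathbb Z/N\mathbb Z)^d$, $$[\mathbf s;\boldsymbol\alpha](q)=\frac{1}{\prod_j(s_j-1)!}\sum_{n\ge1}\Bigg(\sum_{\substack{u_1v_1+\cdots+u_dv_d=n\\ u_1>\cdots>u_d>0,\ v_j\ge1}}\eta^{\sum_j\alpha_jv_j}\prod_j v_j^{s_j-1}\Bigg)q^n,$$ $[\emptyset]=1$; these series converge for $|q|<1$. $\mathrm{Fil}^W_k(\mathcal{MD}_N)$ is the $\mathbb Q_N$-span of all $[\mathbf s;\boldsymbol\alpha]$ with $s_1+\cdots+s_d\le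 k$. Here $q\to1^-$ along real $q\in(0,1)$. *)

(* Defs.v *)
From HB Require Import structures.
From mathcomp Require Import all_boot all_order all_algebra.
From mathcomp Require Import complex.
From mathcomp Require Import all_classical all_reals all_analysis.

Set Implicit Arguments.
Unset Strict Implicit.
Unset Printing Implicit Defensive.

Import Order.TTheory GRing.Theory Num.Theory.
Import numFieldNormedType.Exports.

Local Open Scope classical_set_scope.
Local Open Scope ring_scope.

(* The complex numbers, packed as a numFieldType so that the topology given by
   the modulus and the complex derivative are those of numFieldNormedType. *)
Definition CC (R : realType) : numFieldType := R[i]%C.

Definition toC (R : realType) (x : R) : CC R := x%:C%C.

(* e^(2 pi i / N) *)
Definition eta (R : realType) (N : nat) : CC R :=
  (cos (2 * pi / N%:R) +i* sin (2 * pi / N%:R))%C.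

(* The smallest subfield of the complex numbers containing eta. *)
Definition Q_eta (R : realType) (N : nat) : set (CC R) :=
  [set x | forall K : {pred CC R}, divring_closed K -> eta R N \in K -> x \in K].

(* A residue class mod N is given by its representative in 'I_N (so that N = 1
   is covered, unlike with 'Z_N); eta ^+ a only depends on the class of a.
   Since u_j v_j <= n and u_j, v_j >= 1, all the u_j, v_j occurring in the
   coefficient of q^n are at most n. The constant coefficient is 0, except for
   the empty bracket (d = 0), which is the constant 1. *)
Definition bracket_coef (R : realType) (N d : nat)
    (s : 'I_d -> nat) (alpha : 'I_d -> 'I_N) (n : nat) : CC R :=
  if n == 0%N then (d == 0%N)%:R else
  (\prod_j ((s j).-1)`!%:R)^-1 *
  \sum_(u : {ffun 'I_d -> 'I_n.+1})
  \sum_(v : {ffun 'I_d -> 'I_n.+1} |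
      [&& (\sum_j u j * v j)%N == n,
          [forall i : 'I_d, forall j : 'I_d, (i < j)%N ==> (u j < u i)%N],
          [forall j, (0 < u j)%N] & [forall j, (0 < v j)%N]])
    eta R N ^+ (\sum_j alpha j * v j)%N * \prod_j (v j)%:R ^+ (s j).-1.

Definition bracket (R : realType) (N d : nat)
    (s : 'I_d -> nat) (alpha : 'I_d -> 'I_N) (q : CC R) : CC R :=
  limn (series (fun n => bracket_coef R s alpha n * q ^+ n)).

Definition brackets_le (R : realType) (N k : nat) : set (CC R -> CC R) :=
  [set g | exists d (s : 'I_d -> nat) (alpha : 'I_d -> 'I_N),
    [/\ forall j, (0 < s j)%N, (\sum_j s j <= k)%N & g = bracket s alpha]].

(* The span is a space of functions on the open unit disc, so nothing is
   required of f outside the disc. *)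
Definition FilW (R : realType) (N k : nat) : set (CC R -> CC R) :=
  [set f | exists m (c : 'I_m -> CC R) (g : 'I_m -> CC R -> CC R),
    [/\ forall i, Q_eta N (c i),
        forall i, @brackets_le R N k (g i) &
        forall z, `|z| < 1 -> f z = \sum_i c i * g i z]].

Definition qD (R : realType) (f : CC R -> CC R) (q : CC R) : CC R :=
  q * derive1 f q.

Definition Z_limit (R : realType) (N w : nat) (f : CC R -> CC R) (l : CC R) :=
  (1 - toC q) ^+ w * f (toC q / eta R N) @[q --> (1 : R)^'-] --> l.

(* Main.v *)
(** The coefficients of a bracket of weight at most K are dominated by those of
a product of Lambert-type series sum_(u, v >= 1) v^(s-1) r^(uv) / (s-1)!, each at
most B(r) / (1 - r)^s with B(r) = O(1 - ln(1 - r)); the logarithm is due to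
s = 1. Hence f(z) = O((B(r) / (1 - r))^K) on |z| = r, and a Cauchy-type estimate
between r and (3 + r) / 4 costs one more factor 1 / (1 - r) for f'. In both cases
exactly one factor 1 - r is left over, and (1 - r) B(r)^K tends to 0. *)

Require Import Defs.
From mathcomp Require Import all_boot all_order all_algebra complex ring lra.
From mathcomp Require Import all_classical all_reals all_analysis.
Import Order.TTheory GRing.Theory Num.Theory.
Import numFieldNormedType.Exports.

Set Implicit Arguments.
Unset Strict Implicit.
Unset Printing Implicit Defensive.

Local Open Scope classical_set_scope.
Local Open Scope ring_scope.

(** * Elementary estimates for powers and geometric sums *)

Lemma normr_subXX_le (F : numFieldType) (x y M : F) n :
  `|x| <= M -> `|y| <= M -> `|x ^+ n.+1 - y ^+ n.+1| <= n.+1%:R * M ^+ n * `|x - y|.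
Proof.
move=> hx hy; rewrite subrXX normrM mulrC ler_wpM2r //.
apply: le_trans (ler_norm_sum _ _ _) _.
have -> : n.+1%:R * M ^+ n = \sum_(i < n.+1) M ^+ n.
  by rewrite sumr_const card_ord mulr_natl.
apply: ler_sum => i _; rewrite normrM !normrX.
have -> : M ^+ n = M ^+ (n.+1.-1 - i) * M ^+ i.
  by rewrite -exprD subnK //= -ltnS.
by apply: ler_pM; rewrite ?exprn_ge0 // lerXn2r // nnegrE (le_trans _ hx).
Qed.

(** Already [y ^+ n.+1 - x ^+ n.+1] dominates the left side: it is [y - x] times [n.+1] products,
    each at least [x ^+ n]. *)
Lemma tangent_exprn_le (F : numFieldType) (x y : F) n :
  0 <= x -> x <= y -> n.+1%:R * x ^+ n * (y - x) <= y ^+ n.+1.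
Proof.
move=> x0 xy; have y0 := le_trans x0 xy.
apply: (@le_trans _ _ (y ^+ n.+1 - x ^+ n.+1)); last first.
  by rewrite gerBl exprn_ge0.
rewrite subrXX mulrC ler_wpM2l ?subr_ge0 //.
have -> : n.+1%:R * x ^+ n = \sum_(i < n.+1) x ^+ n.
  by rewrite sumr_const card_ord mulr_natl.
apply: ler_sum => i _.
have -> : x ^+ n = x ^+ (n.+1.-1 - i) * x ^+ i.
  by rewrite -exprD subnK //= -ltnS.
by apply: ler_pM; rewrite ?exprn_ge0 // lerXn2r // nnegrE.
Qed.

Lemma sum_geometric_le (F : numFieldType) (x : F) n : 0 <= x < 1 ->
  \sum_(1 <= v < n) x ^+ v <= x / (1 - x).
Proof.
move=> /andP[x0 x1]; have d0 : 0 < 1 - x by rewrite subr_gt0.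
rewrite ler_pdivlMr //; case: n => [|n]; first by rewrite big_geq // mul0r.
suff -> : (\sum_(1 <= v < n.+1) x ^+ v) * (1 - x) = x - x ^+ n.+1.
  by rewrite gerBl exprn_ge0.
elim: n => [|n IHn]; first by rewrite big_geq // mul0r expr1 subrr.
by rewrite big_nat_recr //= mulrDl IHn mulrBr mulr1 -exprSr addrA subrK.
Qed.

Lemma sum_exprn_geometric_le (F : numFieldType) (x : F) s n : 0 <= x < 1 ->
  \sum_(1 <= v < n) v%:R ^+ s * x ^+ v <= s`!%:R * x / (1 - x) ^+ s.+1.
Proof.
move=> xP; have [x0 x1] := andP xP; have d0 : 0 < 1 - x by rewrite subr_gt0.
elim: s => [|s IHs].
  by under eq_bigr do rewrite expr0 mul1r; rewrite mul1r sum_geometric_le.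
(* Abel summation: multiplying by 1 - x differentiates the weights v ^ s.+1. *)
have abel : (1 - x) * \sum_(1 <= v < n) v%:R ^+ s.+1 * x ^+ v <=
    s.+1%:R * \sum_(1 <= v < n) v%:R ^+ s * x ^+ v.
  case: n {IHs} => [|n]; first by rewrite !big_geq // !mulr0.
  (* The added term is the boundary term of the summation by parts. With it the left side is exactly
     the sum of (v^(s+1) - (v-1)^(s+1)) x^v, so the induction on [n] compares term by term. *)
  apply: (@le_trans _ _ ((1 - x) * (\sum_(1 <= v < n.+1) v%:R ^+ s.+1 * x ^+ v)
      + n%:R ^+ s.+1 * x ^+ n.+1)).
    by rewrite lerDl mulr_ge0 ?exprn_ge0.
  elim: n => [|n IHn]; first by rewrite !big_geq // !mulr0 expr0n mul0r addr0.
  rewrite !(@big_nat_recr _ _ _ n.+1) //= !mulrDr.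
  set S := (1 - x) * _ in IHn *.
  have step : n.+1%:R ^+ s.+1 - n%:R ^+ s.+1 <= s.+1%:R * n.+1%:R ^+ s :> F.
    have le_n : n%:R <= n.+1%:R :> F by rewrite ler_nat.
    have := @normr_subXX_le F n.+1%:R n%:R n.+1%:R s.
    rewrite !ger0_norm ?subr_ge0 ?lerXn2r ?nnegrE // => /(_ (lexx _) le_n).
    by rewrite -natrB // subSnn mulr1.
  rewrite [leLHS](_ : _ = (S + n%:R ^+ s.+1 * x ^+ n.+1) +
      (n.+1%:R ^+ s.+1 - n%:R ^+ s.+1) * x ^+ n.+1); last first.
    by rewrite [x ^+ n.+2]exprS; ring.
  by rewrite lerD // [leRHS]mulrA ler_wpM2r ?exprn_ge0.
rewrite factS natrM exprSr invfM !mulrA ler_pdivlMr // [leLHS]mulrC.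
apply: (le_trans abel); rewrite -!mulrA ler_wpM2l //.
by rewrite !mulrA.
Qed.

(** A weak form of Bernoulli's inequality for 1/r, cleared of denominators so that r = 0 is
    allowed. *)
Lemma exprn_mul1D_le1 (F : numFieldType) (r : F) u : 0 <= r <= 1 ->
  r ^+ u * (1 + u%:R * (1 - r)) <= 1.
Proof.
move=> /andP[r0 r1]; elim: u => [|u IHu]; first by rewrite mul0r addr0 mulr1.
have -> : r ^+ u.+1 * (1 + u.+1%:R * (1 - r)) =
    r * (r ^+ u * (1 + u%:R * (1 - r))) + r ^+ u.+1 * (1 - r).
  by rewrite exprS -natr1; ring.
rewrite -[leRHS](subrKC r) lerD //; first by rewrite ler_piMr.
by rewrite ler_piMl ?subr_ge0 // exprn_ile1.
Qed.

(** Splits a Lambert term into a geometric term and a term of the logarithmic series. With y = u(1 -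
    r), Bernoulli's r^u (1 + y) <= 1 rearranges to 1/(1 - r^u) <= 1 + 1/y. *)
Lemma geometric_ratio_le (F : numFieldType) (r : F) u : 0 <= r < 1 -> (0 < u)%N ->
  r ^+ u / (1 - r ^+ u) <= r ^+ u + r ^+ u / u%:R / (1 - r).
Proof.
move=> /andP[r0 r1] u0; have d0 : 0 < 1 - r by rewrite subr_gt0.
have y0 : 0 < u%:R * (1 - r) by rewrite mulr_gt0 ?ltr0n.
have p1 : r ^+ u < 1 by rewrite exprn_ilt1 // -lt0n.
have -> : r ^+ u + r ^+ u / u%:R / (1 - r) = r ^+ u * (1 + (u%:R * (1 - r))^-1).
  by rewrite invfM mulrDr mulr1 mulrA.
rewrite ler_wpM2l ?exprn_ge0 // -[leLHS]mul1r ler_pdivrMr ?subr_gt0 //.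
have := exprn_mul1D_le1 u (r:=r); rewrite r0 ltW // => /(_ isT) bern.
set y := u%:R * (1 - r) in y0 bern *; set p := r ^+ u in p1 bern *.
have -> : (1 + y^-1) * (1 - p) = (1 + (y - p * (1 + y))) / y.
  by field; rewrite gt_eqF.
by rewrite ler_pdivlMr // mul1r addrCA lerDl subr_ge0.
Qed.

(** * Logarithmic and Lambert series *)

Lemma harmonic_le_ln (R : realType) M :
  \sum_(1 <= u < M.+2) (u%:R : R)^-1 <= 1 + ln M.+1%:R.
Proof.
elim: M => [|M IHM]; first by rewrite big_nat1 invr1 ln1 addr0.
rewrite big_nat_recr //=.
(* The difference of logarithms is -ln(1 - 1/(M+2)), so ln(1 + x) <= x at x = -1/(M+2) suffices. *)
have lnS : (M.+2%:R)^-1 <= ln M.+2%:R - ln M.+1%:R :> R.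
  rewrite -ln_div ?posrE ?ltr0n //.
  have -> : M.+2%:R / M.+1%:R = (1 + - (M.+2%:R)^-1)^-1 :> R.
    rewrite -[LHS]invrK invf_div; congr (_^-1).
    by rewrite -[M.+1%:R](addrK 1) natr1 mulrBl divff ?pnatr_eq0 // div1r.
  have inv_lt1 : (M.+2%:R)^-1 < 1 :> R by rewrite invf_lt1 ?ltr0n // ltr1n.
  rewrite lnV ?posrE ?subr_gt0 // lerNr.
  by rewrite le_ln1Dx // ltrN2.
by rewrite (le_trans (lerD IHM lnS)) // -addrA subrKC.
Qed.

(** This is B(r). The 3 collects 1 from the harmonic sum, 1 from the tail of the logarithmic series,
    and 1 from the geometric series in [sum_lambert_le]. *)
Definition log_majorant (R : realType) (r : R) : R := 3 + ln (2 / (1 - r)).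

Lemma log_majorant_ge3 (R : realType) (r : R) : 0 <= r < 1 -> 3 <= log_majorant r.
Proof.
move=> /andP[r0 r1]; rewrite lerDl ln_ge0 // ler_pdivlMr ?subr_gt0 //.
by rewrite mul1r; lra.
Qed.

Lemma sum_log_series_le (R : realType) (r : R) n : 0 <= r < 1 ->
  \sum_(1 <= u < n) r ^+ u / u%:R <= log_majorant r - 1.
Proof.
move=> rP; have [r0 r1] := andP rP; have d0 : 0 < 1 - r by rewrite subr_gt0.
have dW := ltW d0.
(* Compare with the harmonic sum up to M ~ 1 / (1 - r), and with a geometric
   series beyond. *)
pose M := Num.truncn (1 - r)^-1.
have /andP[M_le lt_M] := truncn_itv (ltW (etrans (invr_gt0 _) d0)).
rewrite -/M in M_le lt_M.
have M0 : 0 < M.+1%:R :> R by rewrite ltr0n.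
(* The range is extended so that the cut at [M.+2] always lies inside it. *)
pose K := (n + M.+2)%N.
have le_nK : (n <= K)%N := leq_addr _ _.
have le_MK : (M.+2 <= K)%N := leq_addl _ _.
have t0 u : 0 <= r ^+ u / u%:R by rewrite divr_ge0 ?exprn_ge0.
have head : \sum_(1 <= u < M.+2) r ^+ u / u%:R <= 1 + ln (2 / (1 - r)).
  apply: (@le_trans _ _ (\sum_(1 <= u < M.+2) (u%:R : R)^-1)).
    apply: ler_sum => u _; rewrite ler_piMl ?invr_ge0 //.
    by rewrite exprn_ile1 // ltW.
  apply: (le_trans (harmonic_le_ln R M)); rewrite lerD2l ler_ln ?posrE //; last first.
    by rewrite divr_gt0.
  (* M + 1 <= 1/(1 - r) + 1 <= 2/(1 - r), whence the 2 inside the logarithm. *)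
  rewrite -natr1 (le_trans (lerD M_le (lexx 1))) //.
  have : 1 <= (1 - r)^-1 by rewrite invr_ge1 ?unitfE ?gt_eqF // gerBl.
  by lra.
have tail : \sum_(M.+2 <= u < K) r ^+ u / u%:R <= 1.
  apply: (@le_trans _ _ ((\sum_(1 <= u < K) r ^+ u) / M.+1%:R)).
    rewrite big_distrl /= [leRHS](@big_cat_nat _ _ _ M.+2) //= ler_wpDl //.
      by apply: sumr_ge0 => u _; rewrite divr_ge0 ?exprn_ge0.
    apply: ler_sum_nat => u /andP[le_Mu _]; rewrite ler_wpM2l ?exprn_ge0 //.
    by rewrite lef_pV2 ?posrE ?ltr0n ?ler_nat // (leq_trans _ le_Mu).
  rewrite ler_pdivrMr // mul1r; apply: (le_trans (sum_geometric_le K rP)).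
  apply: le_trans (ltW lt_M).
  by rewrite -[leRHS]mul1r ler_wpM2r ?invr_ge0 // ltW.
apply: (@le_trans _ _ (\sum_(1 <= u < K) r ^+ u / u%:R)).
  case: n @K le_nK le_MK tail => [|n] K le_nK le_MK tail.
    by rewrite big_geq // sumr_ge0.
  by rewrite [leRHS](@big_cat_nat _ _ _ n.+1) //= lerDl sumr_ge0.
rewrite (@big_cat_nat _ _ _ M.+2) //= (le_trans (lerD head tail)) //.
by rewrite /log_majorant; lra.
Qed.

(** Summing over v first gives s! r^u / (1 - r^u)^(s+1). In s of the denominators 1 - r^u is lowered
    to 1 - r; only the last one is kept, and its sum over u brings in the logarithm. *)
Lemma sum_lambert_le (R : realType) (r : R) s n : 0 <= r < 1 ->
  \sum_(1 <= u < n) \sum_(1 <= v < n) v%:R ^+ s * r ^+ (u * v) <=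
  s`!%:R * (log_majorant r / (1 - r) ^+ s.+1).
Proof.
move=> rP; have [r0 r1] := andP rP; have d0 : 0 < 1 - r by rewrite subr_gt0.
have dW := ltW d0.
have pow_lt1 u : (0 < u)%N -> 0 <= r ^+ u < 1.
  by move=> u0; rewrite exprn_ge0 //= exprn_ilt1 // -lt0n.
have lambert1 : \sum_(1 <= u < n) r ^+ u / (1 - r ^+ u) <= log_majorant r / (1 - r).
  apply: (@le_trans _ _ (\sum_(1 <= u < n) (r ^+ u + r ^+ u / u%:R / (1 - r)))).
    by apply: ler_sum_nat => u /andP[u0 _]; exact: geometric_ratio_le.
  rewrite big_split /= -big_distrl /=.
  have logs := ler_wpM2r (etrans (invr_ge0 _) dW) (sum_log_series_le n rP).
  apply: (le_trans (lerD (sum_geometric_le n rP) logs)).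
  by rewrite -mulrDl ler_wpM2r ?invr_ge0 //; lra.
apply: (@le_trans _ _ (\sum_(1 <= u < n)
    s`!%:R / (1 - r) ^+ s * (r ^+ u / (1 - r ^+ u)))).
  apply: ler_sum_nat => u /andP[u0 _]; have := pow_lt1 _ u0 => /[dup] uP /andP[p0 p1].
  under eq_bigr do rewrite exprM.
  apply: (le_trans (sum_exprn_geometric_le s n uP)).
  have q0 : 0 <= 1 - r ^+ u by rewrite subr_ge0 ltW.
  rewrite exprSr invfM !mulrA ler_wpM2r ?invr_ge0 //.
  rewrite [leRHS]mulrAC ler_wpM2l ?mulr_ge0 //.
  rewrite lef_pV2 ?posrE ?exprn_gt0 ?subr_gt0 // lerXn2r ?nnegrE //.
  by rewrite lerD2l lerN2 -[leRHS]expr1 ler_wiXn2l // ltW.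
rewrite -big_distrr /= [leRHS](_ : _ = s`!%:R / (1 - r) ^+ s * (log_majorant r / (1 - r))).
  by rewrite ler_wpM2l // divr_ge0 ?exprn_ge0.
by rewrite exprSr invfM; ring.
Qed.

(** The exponential beats powers: (B/m)^m <= exp B = 2 e^3 / (1 - r). Hence the square of the left
    side is at most (1 - r)^2 B^m <= c (1 - r). *)
Lemma log_majorant_exp_le (R : realType) K : exists c : R,
  forall r : R, 0 <= r < 1 -> (1 - r) * log_majorant r ^+ K <= Num.sqrt (c * (1 - r)).
Proof.
(* The exponent exceeds 2K, so B^(2K) <= B^m, and it is nonzero even for K = 0, which allows
   division by m. *)
pose m := K.*2.+1; pose c : R := m%:R ^+ m * (expR 3 * 2).
exists c => r rP; have [r0 r1] := andP rP; have d0 : 0 < 1 - r by rewrite subr_gt0.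
have dW := ltW d0.
have B3 := log_majorant_ge3 rP; set B := log_majorant r in B3 *.
have B0 : 0 <= B by lra.
have expB : B ^+ m <= c / (1 - r).
  have -> : c / (1 - r) = m%:R ^+ m * expR B.
    rewrite /B /log_majorant expRD lnK ?posrE ?divr_gt0 //.
    by rewrite /c -!mulrA.
  have -> : B = m%:R * (B / m%:R) by rewrite mulrCA divff ?mulr1 ?pnatr_eq0.
  rewrite expRM_natl -exprMn lerXn2r ?nnegrE ?mulr_ge0 ?invr_ge0 ?expR_ge0 //.
  rewrite ler_wpM2l // (le_trans _ (expR_ge1Dx _)) // lerDr //.
have x0 : 0 <= (1 - r) * B ^+ K by rewrite mulr_ge0 ?exprn_ge0 // ltW.
rewrite -(ger0_norm x0) -sqrtr_sqr ler_wsqrtr //.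
apply: (@le_trans _ _ ((1 - r) ^+ 2 * B ^+ m)).
  rewrite exprMn -exprM muln2 ler_wpM2l ?sqr_ge0 //.
  by rewrite ler_weXn2l //; lra.
apply: (le_trans (ler_wpM2l (sqr_ge0 _) expB)).
by rewrite expr2 le_eqVlt; apply/orP; left; apply/eqP; field; rewrite gt_eqF.
Qed.

(** * Majorants of the bracket coefficients *)

Lemma ler_sum_inj (F : numFieldType) (I J : finType) (h : I -> J)
    (P : pred I) (Q : pred J) (f : I -> F) (g : J -> F) :
  injective h -> (forall i, P i -> Q (h i)) ->
  (forall i, P i -> f i <= g (h i)) -> (forall j, Q j -> 0 <= g j) ->
  \sum_(i | P i) f i <= \sum_(j | Q j) g j.
Proof.
move=> h_inj PQ fg g0; pose D := h @: finset P; apply: (@le_trans _ _ (\sum_(i | P i) g (h i))).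
  exact: ler_sum.
have -> : \sum_(i | P i) g (h i) = \sum_(j in D) g j.
  rewrite /D big_imset /=; last by move=> x y _ _ /h_inj.
  by apply: eq_bigl => i; rewrite inE.
rewrite [leRHS](bigID (mem D)) /=.
rewrite [X in _ <= X + _](eq_bigl (mem D)).
  by rewrite lerDl sumr_ge0 // => j /andP[/g0].
move=> j /=; rewrite andbC; case: imsetP => //= -[x + ->]; rewrite inE => Px.
exact: PQ.
Qed.

(** The coefficient of q^k in the product over j of the series sum_(u, v >= 1) v^(s_j - 1) q^(uv) /
    (s_j - 1)!. The field is a parameter because both [R] and [CC R] occur. *)
Definition bracket_majorant (F : numFieldType) d (s : 'I_d -> nat) (k : nat) : F :=
  if k == 0%N then (d == 0%N)%:R else
  (\prod_j ((s j).-1)`!%:R)^-1 *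
  \sum_(u : {ffun 'I_d -> 'I_k.+1})
  \sum_(v : {ffun 'I_d -> 'I_k.+1} |
      [&& (\sum_j u j * v j)%N == k,
          [forall j, (0 < u j)%N] & [forall j, (0 < v j)%N]])
    \prod_j (v j)%:R ^+ (s j).-1.

(** Families of pairs in a box independent of k give one index set for all k < n, so that the sums
    over k and over families can be exchanged. *)
Lemma bracket_majorant_le (F : numFieldType) d (s : 'I_d -> nat) k n : (k < n)%N ->
  bracket_majorant F s k <= (\prod_j ((s j).-1)`!%:R)^-1 *
  \sum_(w in ffun_on [pred p : 'I_n * 'I_n | (0 < p.1)%N && (0 < p.2)%N]
       | (\sum_j (w j).1 * (w j).2)%N == k)
    \prod_j (w j).2%:R ^+ (s j).-1.
Proof.
move=> lt_kn; have t0 (w : {ffun 'I_d -> 'I_n * 'I_n}) :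
    0 <= \prod_j (w j).2%:R ^+ (s j).-1 :> F.
  by rewrite prodr_ge0 // => j _; rewrite exprn_ge0.
rewrite /bracket_majorant; case: eqP => [->|k0].
  case: eqP => [d0|_]; last first.
    by rewrite mulr_ge0 ?invr_ge0 ?prodr_ge0 // sumr_ge0.
  move: s t0; rewrite d0 => s t0.
  (* For d = 0 the empty family supplies the constant 1. *)
  pose w0 : {ffun 'I_0 -> 'I_n * 'I_n} :=
    [ffun=> (Ordinal lt_kn, Ordinal lt_kn)].
  rewrite (bigD1 w0) /=; last first.
    by rewrite big_ord0 eqxx andbT; apply/ffun_onP => -[].
  by rewrite !big_ord0 invr1 mul1r lerDl sumr_ge0.
rewrite ler_wpM2l ?invr_ge0 ?prodr_ge0 // pair_big_dep /=.
pose h (uv : {ffun 'I_d -> 'I_k.+1} * {ffun 'I_d -> 'I_k.+1}) :=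
  [ffun j => (widen_ord lt_kn (uv.1 j), widen_ord lt_kn (uv.2 j))].
apply: (@ler_sum_inj _ _ _ h) => //.
- move=> [u v] [u' v'] /ffunP eq_h; congr (_, _); apply/ffunP => j;
    have := eq_h j; rewrite !ffunE => -[e1 e2]; exact: val_inj.
- move=> [u v] /= /and3P[/eqP sum_uv /forallP u0 /forallP v0]; apply/andP; split.
    by apply/ffun_onP => j; rewrite ffunE inE /= u0 v0.
  by rewrite -[X in _ == X]sum_uv; apply/eqP; apply: eq_bigr => j _; rewrite ffunE.
- move=> [u v] _ /=; rewrite le_eqVlt; apply/orP; left; apply/eqP.
  by apply: eq_bigr => j _; rewrite ffunE.
Qed.

(* Once the condition u_1 > ... > u_d is dropped, the multiple series is a
   product of simple ones. *)
Lemma sum_bracket_majorant_le (F : numFieldType) d (s : 'I_d -> nat) n (r : F) : 0 <= r ->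
  \sum_(0 <= k < n) bracket_majorant F s k * r ^+ k <=
  \prod_j (((s j).-1)`!%:R^-1 *
    \sum_(1 <= u < n) \sum_(1 <= v < n) v%:R ^+ (s j).-1 * r ^+ (u * v)).
Proof.
move=> r0; set Q := [pred p : 'I_n * 'I_n | (0 < p.1)%N && (0 < p.2)%N].
have -> : \prod_j (((s j).-1)`!%:R^-1 *
      \sum_(1 <= u < n) \sum_(1 <= v < n) v%:R ^+ (s j).-1 * r ^+ (u * v)) =
    (\prod_j ((s j).-1)`!%:R)^-1 *
    \sum_(w in ffun_on Q)
      (\prod_j (w j).2%:R ^+ (s j).-1) * r ^+ (\sum_j (w j).1 * (w j).2).
  rewrite big_split /= prodfV; congr (_ * _).
  rewrite (eq_bigr (fun j => \sum_(p | Q p) p.2%:R ^+ (s j).-1 * r ^+ (p.1 * p.2))).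
    rewrite bigA_distr_big /=; apply: eq_bigr => w _.
    by rewrite big_split /= expr_sum.
  move=> j _; rewrite -(pair_big_dep (fun u : 'I_n => 0 < u)%N (fun _ (v : 'I_n) => 0 < v)%N
    (fun u v : 'I_n => v%:R ^+ (s j).-1 * r ^+ (u * v))) /=.
  rewrite big_geq_mkord; apply: eq_bigr => u _.
  by rewrite big_geq_mkord.
apply: (@le_trans _ _ (\sum_(0 <= k < n) ((\prod_j ((s j).-1)`!%:R)^-1 *
  \sum_(w in ffun_on Q | (\sum_j (w j).1 * (w j).2)%N == k)
    \prod_j (w j).2%:R ^+ (s j).-1) * r ^+ k)).
  by apply: ler_sum_nat => k /andP[_ lt_kn]; rewrite ler_wpM2r ?exprn_ge0 ?bracket_majorant_le.
under [leLHS]eq_bigr do rewrite -mulrA.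
rewrite -big_distrr /= ler_wpM2l ?invr_ge0 ?prodr_ge0 //.
under [leLHS]eq_bigr do rewrite big_distrl big_mkcondr /=.
rewrite exchange_big /=; apply: ler_sum => w _.
have t0 : 0 <= \prod_j (w j).2%:R ^+ (s j).-1 :> F.
  by rewrite prodr_ge0 // => j _; rewrite exprn_ge0.
rewrite big_mkord -big_mkcond /=.
(* A family contributes on the left only at the k equal to its degree; if that degree reaches [n],
   its left contribution is 0. *)
have [lt_n|le_n] := ltnP (\sum_j (w j).1 * (w j).2) n.
  by rewrite (big_pred1 (Ordinal lt_n)) //= => k; rewrite -val_eqE eq_sym.
rewrite big_pred0 ?mulr_ge0 ?exprn_ge0 // => k.
by apply/negbTE; rewrite neq_ltn (leq_trans (ltn_ord k) le_n) orbT.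
Qed.

(** * Complex moduli and dominated series *)

Definition cabs (R : realType) (z : CC R) : R := complex.Re `|z|.

Lemma toC_cabs (R : realType) (z : CC R) : toC (cabs z) = `|z|.
Proof. by rewrite /toC /cabs; apply: RRe_real; exact: normr_real. Qed.

Lemma ler_toC (R : realType) (x y : R) : (toC x <= toC y) = (x <= y).
Proof. exact: lecR. Qed.

Lemma toC_gt0P (R : realType) (e : CC R) : 0 < e -> exists2 x : R, 0 < x & e = toC x.
Proof.
case: e => a b; rewrite ltcE /= => /andP[/eqP -> a0].
by exists a.
Qed.

Lemma cabs_ReIm (R : realType) (z : CC R) :
  `|z| <= toC (`|complex.Re z| + `|complex.Im z|).
Proof.
rewrite normc_def ler_toC; case: z => a b /=.
have ab0 : 0 <= `|a| + `|b| by rewrite addr_ge0.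
rewrite -[leRHS](ger0_norm ab0) -[leRHS]sqrtr_sqr ler_wsqrtr // sqrrD !real_normK ?num_real //.
by rewrite addrAC lerDl mulrn_wge0 // mulr_ge0.
Qed.

(** The order on [CC R] is partial, so the comparison is moved to [R], where a bound by b + e for
    every e > 0 suffices. *)
Lemma norm_cvg_le (R : realType) (T : Type) (F : set_system T) {FF : ProperFilter F}
    (f : T -> CC R) (l : CC R) (b : R) :
  f @ F --> l -> (\near F, `|f F| <= toC b) -> `|l| <= toC b.
Proof.
move=> fl fb; rewrite -toC_cabs ler_toC; apply/ler_addgt0Pr => e e0.
have e0' : 0 < toC e by rewrite -[0]/(toC 0) ltcR.
move/cvgrPdist_le : fl => /(_ _ e0') dist_l.
have [x [/= dist_x b_x]] := filter_ex (filterI dist_l fb).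
rewrite -ler_toC toC_cabs -(subrK (f x) l) addrC.
rewrite (le_trans (ler_normD _ _)) // [toC _](_ : _ = toC b + toC e); last by rewrite /toC rmorphD.
exact: lerD.
Qed.

(* R[i] carries no instance of completeType, hence the detour through Re and Im. *)
Lemma dominated_series (R : realType) (u : nat -> CC R) (v : nat -> R) (B : R) :
  (forall k, `|u k| <= toC (v k)) -> (forall n, \sum_(0 <= k < n) v k <= B) ->
  cvgn (series u) /\ `|limn (series u)| <= toC B.
Proof.
move=> le_uv le_vB.
have v0 k : 0 <= v k by rewrite -ler_toC; apply: le_trans (le_uv k); exact: normr_ge0.
have real_part (g : nat -> R) : (forall k, `|g k| <= v k) -> cvgn (series g).
  move=> le_gv; apply: normed_cvg.
  apply: (@series_le_cvg _ (fun k => `|g k|) v) => //.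
  apply: (@nondecreasing_is_cvgn _ (series v)).
    by apply: nondecreasing_series.
  by exists B => _ [n _ <-]; exact: le_vB.
have cvg_re : cvgn (series (fun k => complex.Re (u k))).
  apply: real_part => k; rewrite -ler_toC; apply: le_trans (le_uv k).
  exact: normc_ge_Re.
have cvg_im : cvgn (series (fun k => complex.Im (u k))).
  apply: real_part => k; rewrite -ler_toC; apply: le_trans (le_uv k).
  (* Up to sign the imaginary part is the real part of [u k * 'i], which has the same modulus. *)
  have := normc_ge_Re (u k * 'i%C); rewrite ReiNIm normrN => /le_trans; apply.
  by rewrite normrM [X in _ * X](_ : _ = 1) ?mulr1 // normc_def /= expr0n /= add0r expr1n sqrtr1.
pose l : CC R := (limn (series (fun k => complex.Re (u k))) +i*
  limn (series (fun k => complex.Im (u k))))%C.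
have cvg_u : series u @ \oo --> l.
  have series_ReIm n : series u n =
      (series (fun k => complex.Re (u k)) n +i* series (fun k => complex.Im (u k)) n)%C.
    rewrite /series /=; elim: n => [|n IHn]; first by rewrite !big_geq.
    by rewrite !big_nat_recr //= IHn; case: (u n).
  apply/cvgrPdist_le => _ /toC_gt0P[e e0 ->].
  have e2 : 0 < e / 2 by rewrite divr_gt0.
  move/cvgrPdist_le : cvg_re => /(_ _ e2) near_re.
  move/cvgrPdist_le : cvg_im => /(_ _ e2) near_im.
  near=> n; apply: (le_trans (cabs_ReIm _)); rewrite ler_toC series_ReIm.
  rewrite (splitr e) /=; apply: lerD.
    by near: n.
  by near: n.
split; first by apply/cvg_ex; exists l.
rewrite (cvg_lim _ cvg_u) //; apply: (norm_cvg_le cvg_u); near=> n.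
rewrite (le_trans (ler_norm_sum _ _ _)) //.
apply: (@le_trans _ _ (\sum_(0 <= k < n) toC (v k))); first exact: ler_sum.
by rewrite /toC -rmorph_sum lecR.
Unshelve. all: by end_near. Qed.

(** * Growth of brackets in the unit disc *)

Lemma norm_eta (R : realType) N : `|eta R N| = 1.
Proof. by rewrite normc_def /= cos2Dsin2 sqrtr1. Qed.

Lemma toC_bracket_majorant (R : realType) d (s : 'I_d -> nat) k :
  bracket_majorant (CC R) s k = toC (bracket_majorant R s k).
Proof.
rewrite /bracket_majorant /toC; case: ifP => _; first by rewrite rmorph_nat.
rewrite rmorphM fmorphV rmorph_prod rmorph_sum; congr (_^-1 * _).
  by apply: eq_bigr => j _; rewrite rmorph_nat.
apply: eq_bigr => u _; rewrite rmorph_sum; apply: eq_bigr => v _.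
by rewrite rmorph_prod; apply: eq_bigr => j _; rewrite rmorphXn rmorph_nat.
Qed.

(** Powers of [eta] have modulus 1, and dropping the ordering of the u_j only adds nonnegative
    terms. *)
Lemma norm_bracket_coef_le (R : realType) N d (s : 'I_d -> nat) (alpha : 'I_d -> 'I_N) k :
  `|bracket_coef R s alpha k| <= toC (bracket_majorant R s k).
Proof.
rewrite -toC_bracket_majorant /bracket_coef /bracket_majorant.
case: ifP => _; first by rewrite normr_nat.
have fact0 : 0 <= (\prod_j ((s j).-1)`!%:R)^-1 :> CC R by rewrite invr_ge0 prodr_ge0.
rewrite normrM ger0_norm // ler_wpM2l //.
apply: (le_trans (ler_norm_sum _ _ _)); apply: ler_sum => u _.
apply: (le_trans (ler_norm_sum _ _ _)); apply: (@ler_sum_inj _ _ _ id) => //.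
- by move=> v /and4P[-> _ -> ->].
- move=> v _; rewrite normrM normrX norm_eta expr1n mul1r ger0_norm //.
  by rewrite prodr_ge0 // => j _; rewrite exprn_ge0.
- by move=> v _; rewrite prodr_ge0 // => j _; rewrite exprn_ge0.
Qed.

Definition growth_bound (R : realType) (K : nat) (r : R) : R :=
  (log_majorant r / (1 - r)) ^+ K.

Lemma growth_bound_ge0 (R : realType) K (r : R) : 0 <= r < 1 -> 0 <= growth_bound K r.
Proof.
move=> rP; have [_ r1] := andP rP; rewrite exprn_ge0 // divr_ge0 ?subr_ge0 ?(ltW r1) //.
by rewrite (le_trans _ (log_majorant_ge3 rP)).
Qed.

(** The factor of index j is at most B/(1 - r)^(s_j) <= (B/(1 - r))^(s_j), since B >= 1. The
    exponents add up to the weight, which may be raised to [K] because B/(1 - r) >= 1. *)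
Lemma bracket_majorant_growth (R : realType) d (s : 'I_d -> nat) K n (r : R) :
  0 <= r < 1 -> (forall j, 0 < s j)%N -> (\sum_j s j <= K)%N ->
  \sum_(0 <= k < n) bracket_majorant R s k * r ^+ k <= growth_bound K r.
Proof.
move=> rP s0 sK; have [r0 r1] := andP rP; have B3 := log_majorant_ge3 rP.
have d0 : 0 < 1 - r by rewrite subr_gt0.
have dW := ltW d0.
have B1 : 1 <= log_majorant r by rewrite (le_trans _ B3) // ler1n.
apply: (le_trans (sum_bracket_majorant_le s n r0)).
have E1 : 1 <= log_majorant r / (1 - r).
  by rewrite ler_pdivlMr // mul1r (le_trans _ B1) // gerBl.
apply: le_trans (_ : _ <= (log_majorant r / (1 - r)) ^+ (\sum_j s j)) _; last first.
  by rewrite /growth_bound ler_weXn2l.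
rewrite expr_sum; apply: ler_prod => j _; apply/andP; split.
  rewrite mulr_ge0 ?invr_ge0 // sumr_ge0 // => u _; rewrite sumr_ge0 // => v _.
  by rewrite mulr_ge0 ?exprn_ge0.
rewrite mulrC ler_pdivrMr ?ltr0n ?fact_gt0 // mulrC.
apply: (le_trans (sum_lambert_le _ n rP)); rewrite ler_wpM2l // prednK // expr_div_n.
by rewrite ler_wpM2r ?invr_ge0 ?exprn_ge0 // -[leLHS]expr1 ler_weXn2l.
Qed.

Lemma bracket_series_le (R : realType) N d (s : 'I_d -> nat) (alpha : 'I_d -> 'I_N)
    K (r : R) (z : CC R) :
  (forall j, 0 < s j)%N -> (\sum_j s j <= K)%N -> 0 <= r < 1 -> `|z| <= toC r ->
  cvgn (series (fun n => bracket_coef R s alpha n * z ^+ n)) /\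
  `|bracket s alpha z| <= toC (growth_bound K r).
Proof.
move=> s0 sK rP zr.
apply: (@dominated_series _ _ (fun k => bracket_majorant R s k * r ^+ k)).
  move=> k; rewrite /toC rmorphM rmorphXn normrM normrX.
  apply: ler_pM; rewrite ?exprn_ge0 //; first exact: norm_bracket_coef_le.
  by rewrite lerXn2r ?nnegrE // (le_trans _ zr).
by move=> n; exact: bracket_majorant_growth.
Qed.

(* The tangent inequality n M^(n-1) (t - M) <= t^n bounds the differentiated
   series at M by the series at t. *)
Lemma bracket_lipschitz (R : realType) N d (s : 'I_d -> nat) (alpha : 'I_d -> 'I_N)
    K (M t : R) (z z' : CC R) :
  (forall j, 0 < s j)%N -> (\sum_j s j <= K)%N -> 0 <= M -> M < t -> t < 1 ->
  `|z| <= toC M -> `|z'| <= toC M ->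
  `|bracket s alpha z - bracket s alpha z'| <= toC (growth_bound K t / (t - M)) * `|z - z'|.
Proof.
move=> s0 sK M0 Mt t1 zM zM'.
have MP : 0 <= M < 1 by rewrite M0 (lt_trans Mt).
have tP : 0 <= t < 1 by rewrite (le_trans M0 (ltW Mt)).
have tM0 : 0 < t - M by rewrite subr_gt0.
have [cz _] := bracket_series_le alpha s0 sK MP zM.
have [cz' _] := bracket_series_le alpha s0 sK MP zM'.
pose u k := bracket_coef R s alpha k * (z ^+ k - z' ^+ k).
have -> : bracket s alpha z - bracket s alpha z' = limn (series u).
  rewrite /bracket -(limB cz cz'); congr (limn _); apply/funext => n.
  rewrite fctE /series /= -sumrB.
  by apply: eq_bigr => k _; rewrite -mulrBr.
pose v k := bracket_majorant R s k * t ^+ k * (cabs (z - z') / (t - M)).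
have c0 : 0 <= cabs (z - z') / (t - M).
  by rewrite divr_ge0 ?(ltW tM0) // -ler_toC toC_cabs; exact: normr_ge0.
rewrite -toC_cabs [leRHS](_ : _ = toC (growth_bound K t * (cabs (z - z') / (t - M)))); last first.
  by rewrite /toC -rmorphM; congr (_%:C)%C; rewrite mulrAC mulrA.
apply: (@dominated_series _ u v _ _ _).2 => [k|n]; last first.
  by rewrite -big_distrl /= ler_wpM2r // bracket_majorant_growth.
rewrite /u /v normrM -mulrA /toC rmorphM -/toC; apply: ler_pM => //.
  exact: norm_bracket_coef_le.
case: k => [|k]; first by rewrite subrr normr0 mul1r -[0]/(toC 0) ler_toC.
(* The difference of powers is at most (k+1) M^k |z - z'|, hence at most t^(k+1) |z - z'| / (t - M)
   by the tangent inequality. *)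
apply: (le_trans (normr_subXX_le _ zM zM')); rewrite -toC_cabs.
rewrite -[_ * toC _ ^+ _](_ : toC (k.+1%:R * M ^+ k) = _); last first.
  by rewrite /toC rmorphM rmorphXn rmorph_nat.
rewrite /toC -rmorphM lecR mulrA ler_pdivlMr // mulrAC ler_wpM2r //.
  by rewrite -ler_toC toC_cabs; exact: normr_ge0.
by rewrite tangent_exprn_le // ltW.
Qed.

(** * Growth of linear combinations and of their derivatives *)

Definition span_growth (R : realType) (K : nat) (C : R) (f : CC R -> CC R) : Prop :=
  (forall r z, 0 <= r < 1 -> `|z| <= toC r -> `|f z| <= toC (C * growth_bound K r)) /\
  (forall M t z z', 0 <= M -> M < t -> t < 1 -> `|z| <= toC M -> `|z'| <= toC M ->
    `|f z - f z'| <= toC (C * growth_bound K t / (t - M)) * `|z - z'|).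

(** Both estimates pass to linear combinations, with C the sum of the moduli of the coefficients. *)
Lemma FilW_span_growth (R : realType) (N K : nat) (f : CC R -> CC R) :
  FilW N K f -> exists2 C : R, 0 <= C & span_growth K C f.
Proof.
move=> [m [c [g [_ gK fE]]]]; exists (\sum_i cabs (c i)).
  by apply: sumr_ge0 => i _; rewrite -ler_toC toC_cabs; exact: normr_ge0.
have toC_sumM x : toC ((\sum_i cabs (c i)) * x) = \sum_i `|c i| * toC x.
  rewrite big_distrl /= /toC rmorph_sum; apply: eq_bigr => i _.
  by rewrite rmorphM -toC_cabs.
(* The expansion [fE] of [f] is available only inside the open unit disc. *)
have in_disc (M : R) (z : CC R) : M < 1 -> `|z| <= toC M -> `|z| < 1.
  by move=> M1 zM; apply: (le_lt_trans zM); rewrite -[1]/(toC 1) ltcR.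
split=> [r z rP zr|M t z z' M0 Mt t1 zM zM'].
  have [_ r1] := andP rP; rewrite fE ?(in_disc r) // toC_sumM.
  apply: (le_trans (ler_norm_sum _ _ _)); apply: ler_sum => i _.
  rewrite normrM ler_wpM2l //.
  have [d [s [alpha [s0 sK ->]]]] := gK i.
  by have [] := bracket_series_le alpha s0 sK rP zr.
have M1 := lt_trans Mt t1.
rewrite !fE ?(in_disc M) // -sumrB -mulrA toC_sumM big_distrl /=.
apply: (le_trans (ler_norm_sum _ _ _)); apply: ler_sum => i _.
rewrite -mulrBr normrM -mulrA ler_wpM2l //.
have [d [s [alpha [s0 sK ->]]]] := gK i.
exact: bracket_lipschitz.
Qed.

(* No differentiability is needed: a divergent [lim] is [point], that is 0. *)
Lemma span_growth_derive1 (R : realType) (K : nat) (C : R) (f : CC R -> CC R)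
    (r M t : R) (z : CC R) :
  0 <= C -> span_growth K C f -> 0 <= r -> r < M -> M < t -> t < 1 -> `|z| <= toC r ->
  `|derive1 f z| <= toC (C * growth_bound K t / (t - M)).
Proof.
move=> C0 [_ f_lip] r0 rM Mt t1 zr.
have M0 : 0 <= M := le_trans r0 (ltW rM).
rewrite /derive1; set F := (X in lim X); have [cvgF|dvgF] := pselect (cvg F).
  apply: (norm_cvg_le cvgF).
  (* For |h| < M - r both z and z + h stay in the disc of radius M, so the Lipschitz estimate bounds
     the difference quotient. *)
  have e0 : 0 < toC (M - r) by rewrite -[0]/(toC 0) ltcR subr_gt0.
  near=> h.
  have h0 : h != 0 by near: h; exact: nbhs_dnbhs_neq.
  have hM : `|h| < toC (M - r) by near: h; exact: dnbhs0_lt.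
  rewrite normrZ normfV mulrC ler_pdivrMr ?normr_gt0 //.
  rewrite -[X in _ * `|X|](addrK z h).
  apply: f_lip => //; last first.
    by apply: (le_trans zr); rewrite ler_toC ltW.
  apply: (le_trans (ler_normD _ _)); apply: (le_trans (lerD (ltW hM) zr)).
  by have -> : toC (M - r) + toC r = toC M by rewrite /toC -rmorphD subrK.
rewrite (dvgP dvgF) [point](_ : _ = 0) // normr0 -[0]/(toC 0) ler_toC.
by rewrite divr_ge0 ?subr_ge0 ?mulr_ge0 ?growth_bound_ge0 ?t1 ?(ltW Mt) // (le_trans M0) // ltW.
Unshelve. all: by end_near. Qed.

(** * The limit as q tends to 1 from the left *)

Lemma growth_boundM (R : realType) K (r : R) : r < 1 ->
  (1 - r) ^+ K.+1 * growth_bound K r = (1 - r) * log_majorant r ^+ K.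
Proof.
move=> r1; have d0 : (1 - r) ^+ K != 0 by rewrite expf_neq0 // subr_eq0 gt_eqF.
by rewrite /growth_bound expr_div_n exprS -mulrA (mulrC _ (_ / _)) divfK.
Qed.

Lemma cvg_sqrt_majorant (R : realType) (F : R -> CC R) (A c : R) :
  (forall q, 0 < q < 1 -> `|F q| <= toC (A * Num.sqrt (c * (1 - q)))) ->
  F q @[q --> (1 : R)^'-] --> (0 : CC R).
Proof.
move=> F_le; apply/cvgr0Pnorm_le => _ /toC_gt0P[e e0 ->].
have b_cvg : A * Num.sqrt (c * (1 - q)) @[q --> (1 : R)^'-] --> (0 : R).
  have -> : 0 = A * Num.sqrt (c * (1 - 1)) by rewrite subrr mulr0 sqrtr0 mulr0.
  apply: cvgMl_tmp; apply: (@continuous_cvg _ _ _ _ _ _ Num.sqrt); first exact: sqrt_continuous.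
  by apply: cvg_at_left_filter; apply: cvgMl_tmp; apply: cvgB; [exact: cvg_cst | exact: cvg_id].
move/cvgr0Pnorm_le : b_cvg => /(_ _ e0) b_le.
near=> q; apply: (@le_trans _ _ (toC (A * Num.sqrt (c * (1 - q))))).
  apply: F_le; apply/andP; split; first by near: q; apply: nbhs_left_gt.
  by near: q; exact: nbhs_left_lt.
rewrite ler_toC; apply: (le_trans (ler_norm _)); near: q; exact: b_le.
Unshelve. all: by end_near. Qed.

Theorem theorem7p5 (R : realType) (w N : nat) (hw : (3 <= w)%N) (hN : (1 <= N)%N) :
  (forall f : CC R -> CC R, FilW N (w - 1) f -> Z_limit N w f 0) /\
  (forall f : CC R -> CC R, FilW N (w - 2) f -> Z_limit N w (qD f) 0).
Proof.
have norm_arg (q : R) : 0 < q -> `|toC q / eta R N| = toC q.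
  move=> q0; rewrite normrM normfV norm_eta invr1 mulr1 ger0_norm //.
  by rewrite -[0]/(toC 0) ler_toC ltW.
have norm_factor (q : R) : q < 1 -> `|(1 - toC q) ^+ w| = toC ((1 - q) ^+ w).
  move=> q1; rewrite /toC rmorphXn rmorphB ger0_norm // exprn_ge0 //.
  by rewrite subr_ge0 -[1]/(toC 1) ler_toC ltW.
split=> f Ff; have [C C0 fC] := FilW_span_growth Ff.
  have [c c_le] := log_majorant_exp_le R (w - 1).
  apply: (@cvg_sqrt_majorant _ _ C c) => q /andP[q0 q1].
  have qP : 0 <= q < 1 by rewrite ltW.
  rewrite normrM norm_factor //.
  apply: le_trans (ler_wpM2l _ (fC.1 q _ qP _)) _; rewrite ?norm_arg //.
    by rewrite -[0]/(toC 0) ler_toC exprn_ge0 // subr_ge0 ltW.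
  rewrite /toC -rmorphM lecR mulrCA ler_wpM2l //.
  (* Of the [w] factors 1 - q, all but one cancel the poles of the growth bound. *)
  have {1}-> : w = (w - 1).+1 by rewrite subn1 prednK // (leq_trans _ hw).
  by rewrite growth_boundM // c_le.
have [c c_le] := log_majorant_exp_le R (w - 2).
(* The constants come from 1 - q = 4(1 - t) for the radius t below: this gives (1 - q)^w = 4^w (1 -
   t)^w and (c/4)(1 - q) = c(1 - t). *)
apply: (@cvg_sqrt_majorant _ _ (C * 4 ^+ w) (c / 4)) => q /andP[q0 q1].
(* M is the midpoint of q and 1, and t that of M and 1, so t - M = 1 - t. *)
pose M := (1 + q) / 2; pose t := (3 + q) / 4.
have tP : 0 <= t < 1 by rewrite /t; apply/andP; split; lra.
have f'_le : `|derive1 f (toC q / eta R N)| <= toC (C * growth_bound (w - 2) t / (t - M)).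
  apply: (@span_growth_derive1 _ _ _ _ q) => //; rewrite ?norm_arg //; rewrite /M /t; lra.
rewrite normrM norm_factor // /qD normrM norm_arg //.
apply: (@le_trans _ _ (toC ((1 - q) ^+ w * (C * growth_bound (w - 2) t / (t - M))))).
  rewrite /toC rmorphM ler_wpM2l //.
    by rewrite -[0]/(toC 0) ler_toC exprn_ge0 // subr_ge0 ltW.
  by apply: le_trans f'_le; rewrite ler_piMl // -[1]/(toC 1) ler_toC ltW.
have -> : t - M = 1 - t by rewrite /t /M; lra.
have -> : 1 - q = 4 * (1 - t) by rewrite /t; lra.
rewrite ler_toC exprMn (mulrC C) -!mulrA [leRHS]mulrCA ler_wpM2l ?exprn_ge0 //.
have t0 : 0 < 1 - t by rewrite subr_gt0; case/andP: tP.
(* One factor 1 - t cancels the denominator t - M, and w - 2 cancel the growth bound; one is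
   left. *)
have {1}-> : w = (w - 2).+2 by rewrite -[w in LHS](subnK (ltnW hw)) addn2.
rewrite [leLHS](_ : _ = C * ((1 - t) ^+ (w - 2).+1 * growth_bound (w - 2) t)); last first.
  by rewrite exprSr; field; rewrite gt_eqF.
rewrite growth_boundM //; last by case/andP: tP.
by rewrite ler_wpM2l // mulKf ?pnatr_eq0 ?c_le.
Qed.
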